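(* Let $n,m,\ell$ be positive integers, let $J\subseteq\mathbb{R}$ be an interval with $0\in J$, let $f:J\to\mathbb{R}$ be a convex function with $f(0)\leq 0$, and let $A\in\mathcal{H}_n(J)$. Let $\Phi_1,\dots,\Phi_\ell$ be positive linear maps from $\mathcal{M}_n$ to $\mathcal{M}_m$ and let $\alpha_1,\dots,\alpha_\ell\geq 0$ be real numbers such that $0\leq\sum_{i=1}^{\ell}\alpha_i\Phi_i(I_n)\leq I_m$. Then $$\sum_{j=1}^{k}\lambda_j\left(f\left(\sum_{i=1}^{\ell}\alpha_i\Phi_i(A)\right)\right)\leq\sum_{j=1}^{k}\lambda_j\left(\sum_{i=1}^{\ell}\alpha_i\Phi_i(f(A))\right)\qquad(1\leq k\leq m).$$
   Context: $\mathcal{M}_n$ denotes the $C^*$-algebra of $n\times n$ complex matrices, $I_n$ its identity matrix, and $\mathcal{H}_n(J)$ the set of Hermitian matrices in $\mathcal{M}_n$ whose spectra are contained in the interval $J$. For Hermitian $A,B\in\mathcal{M}_n$, $A\leq B$ means $\langle Ax,x\rangle\leq\langle Bx,x\rangle$ for all $x\in\mathbb{C}^n$; $A\geq 0$ means $A$ is positive semidefinite. A linear map $\Phi:\mathcal{M}_n\to\mathcal{M}_m$ is positive if $\Phi(A)\geq 0$ whenever $A\geq 0$. For a Hermitian matrix $A$, $\lambda_1(A)\geq\lambda_2(A)\geq\cdots$ denote its eigenvalues in decreasing order, counted with multiplicity. $f(A)$ is defined by the functional calculus for Hermitian matrices. *)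

(* Defs.v *)
From mathcomp Require Import all_boot all_order all_algebra complex.
From mathcomp Require Import all_classical all_reals all_analysis.

Set Implicit Arguments.
Unset Strict Implicit.
Unset Printing Implicit Defensive.

Import Order.TTheory GRing.Theory Num.Theory.
Local Open Scope ring_scope.
Local Open Scope sesquilinear_scope.
Local Open Scope complex_scope.

Section HermitianMatrices.
Variable R : realType.

(* <A x, x> for a column vector x. *)
Definition qform n (A : 'M[R[i]]_n) (x : 'cV[R[i]]_n) : R[i] :=
  (x ^t* *m (A *m x)) 0 0.

(* In R[i], z <= w means that w - z is a nonnegative real number. *)
Definition loewner_le n (A B : 'M[R[i]]_n) : Prop :=
  [/\ A \is hermsymmx, B \is hermsymmx & forall x, qform A x <= qform B x].

Definition positive_map n m (Phi : 'M[R[i]]_n -> 'M[R[i]]_m) : Prop :=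
  forall A, loewner_le 0 A -> loewner_le 0 (Phi A).

(* The set H_n(J). *)
Definition herm_in n (J : set R) (A : 'M[R[i]]_n) : Prop :=
  A \is hermsymmx /\
  forall z : R[i], eigenvalue A z -> exists2 x : R, J x & z = x%:C.

(* Meaningful for Hermitian A, whose [spectral_diag] is real.  The result does
   not depend on the diagonalization chosen by [spectralmx] (see [mxfunE]), and
   only the values of f on the spectrum of A matter. *)
Definition mxfun n (f : R -> R) (A : 'M[R[i]]_n) : 'M[R[i]]_n :=
  invmx (spectralmx A)
    *m diag_mx (map_mx (fun z : R[i] => (f (complex.Re z))%:C) (spectral_diag A))
    *m spectralmx A.

(* Eigenvalues of a Hermitian matrix with multiplicity, in decreasing order;
   indices start at 0: the largest eigenvalue is [lambda A 0]. *)
Definition eigvals n (A : 'M[R[i]]_n) : seq R :=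
  sort (fun x y => y <= x)
    [seq complex.Re (spectral_diag A 0 i) | i <- enum 'I_n].

Definition lambda n (A : 'M[R[i]]_n) (j : nat) : R := (eigvals A)`_j.

Lemma spectral_diag_Re n (A : 'M[R[i]]_n) i : A \is hermsymmx ->
  (complex.Re (spectral_diag A 0 i))%:C = spectral_diag A 0 i.
Proof.
by move=> /hermitian_spectral_diag_real /mxOverP /(_ 0 i) /RRe_real.
Qed.

Lemma mxfunE n (f : R -> R) (A P : 'M[R[i]]_n) (d : 'rV[R]_n) :
  P \is unitarymx -> A = invmx P *m diag_mx (map_mx (real_complex R) d) *m P ->
  mxfun f A = invmx P *m diag_mx (\row_i (f (d 0 i))%:C) *m P.
Proof.
move=> Pu AE; have Pv := unitarymx_unit Pu.
have nA : A \is normalmx.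
  by apply/orthomx_spectral_subproof; exists (P, map_mx (real_complex R) d).
have Qv := spectral_unit A; move/orthomx_spectralP: nA => AE'.
rewrite /mxfun; set Q := spectralmx A in Qv AE' *.
set e := spectral_diag A in AE' *.
pose W := Q *m invmx P.
have WE : W *m diag_mx (map_mx (real_complex R) d) = diag_mx e *m W.
  have : Q *m A *m invmx P = Q *m A *m invmx P by [].
  rewrite {1}AE {1}AE' /W !mulmxA mulmxK // => ->.
  by rewrite mulmxV // mul1mx.
have WfE : W *m diag_mx (\row_i (f (d 0 i))%:C) =
    diag_mx (map_mx (fun z => (f (complex.Re z))%:C) e) *m W.
  apply/matrixP => i j; move/matrixP/(_ i j): WE; move: (W) => {}W.
  rewrite !mul_mx_diag !mul_diag_mx !mxE.
  case: (eqVneq (W i j) 0) => [-> _|W0]; first by rewrite mul0r mulr0.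
  rewrite mulrC => /(mulIf W0) <-; by rewrite mulrC.
have QE : Q = W *m P by rewrite /W mulmxKV.
rewrite -[LHS]mulmxA [in X in _ *m (_ *m X)]QE (mulmxA _ W) -WfE /W.
by rewrite !mulmxA mulVmx // mul1mx.
Qed.

Lemma char_poly_eigvals n (A : 'M[R[i]]_n) : A \is hermsymmx ->
  char_poly A = \prod_(x <- eigvals A) ('X - (x%:C)%:P).
Proof.
move=> hA; rewrite /eigvals.
rewrite (perm_big _ (permEl (perm_sort _ _))) big_map big_enum /=.
have /orthomx_spectralP AE := hermitian_normalmx hA.
have Qv := spectral_unit A.
have -> : char_poly A = char_poly (diag_mx (spectral_diag A)).
  rewrite {1}AE /char_poly; set Q := spectralmx A in Qv *.
  set D := diag_mx _.
  have -> : char_poly_mx (invmx Q *m D *m Q) =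
      map_mx polyC (invmx Q) *m char_poly_mx D *m map_mx polyC Q.
    rewrite /char_poly_mx mulmxBr mulmxBl scalar_mxC -[_%:M *m _ *m _]mulmxA -!map_mxM.
    by rewrite mulVmx // map_mx1 mulmx1.
  rewrite !det_mulmx mulrAC -det_mulmx -map_mxM mulVmx // map_mx1 det1.
  by rewrite mul1r.
rewrite char_poly_trig ?diag_mx_is_trig //; apply: eq_bigr => i _.
by rewrite spectral_diag_Re // mxE eqxx.
Qed.

End HermitianMatrices.

(* Main.v *)
From HB Require Import structures.
Require Import Defs.
From mathcomp Require Import all_boot all_order all_algebra complex.
From mathcomp Require Import all_classical all_reals all_analysis.
From mathcomp Require Import lra.

(** The weighted sum Psi of the maps Phi_i is itself a positive linear map, with
Psi(I) <= I, so only Psi matters.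

The heart of the matter is a scalar inequality: for a unit vector x,
f(<Psi(A) x, x>) <= <Psi(f(A)) x, x> ([convex_compression_le]).  Write A as the
sum of a_i P_i over the spectral projections P_i.  The numbers
w_i = <Psi(P_i) x, x> are nonnegative and add up to <Psi(I) x, x> <= 1, and the
two sides are f(sum w_i a_i) and sum w_i f(a_i).  So this is Jensen's inequality
for weights of total mass at most 1, the missing mass being put at 0, where
f <= 0 ([jensen_subprob]).

Now let u_j be an orthonormal eigenbasis of Psi(A), with eigenvalues b_j.  The
eigenvalues of f(Psi(A)) are the f(b_j) ([eigvals_udiag]), so the k largest of
them add up to the sum of f(<Psi(A) u_j, u_j>) over some set of k indices.  By
the scalar inequality this is at most the sum of <Psi(f(A)) u_j, u_j> over that
set, and by Ky Fan's maximum principle ([ky_fan_le]) that is at most the sum of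
the k largest eigenvalues of Psi(f(A)). *)

Set Implicit Arguments.
Unset Strict Implicit.
Unset Printing Implicit Defensive.

Import Order.TTheory GRing.Theory Num.Theory.
Local Open Scope ring_scope.
Local Open Scope sesquilinear_scope.
Local Open Scope complex_scope.

(** * Scalar inequalities *)

(** Induction peels off one point a_i of weight w_i: the other weights, divided
by 1 - w_i, again have total mass at most 1, so that the whole sum is a convex
combination of a_i and of a point covered by the induction hypothesis.  The
empty sum is the point 0, and this is where f(0) <= 0 is used. *)
Lemma jensen_subprob (R : realType) (J : set R) (f : R -> R) (I : Type)
    (s : seq I) (w a : I -> R) :
  is_interval J -> J 0 -> @convex_function R R^o J f -> f 0 <= 0 ->
  (forall i, J (a i)) -> (forall i, 0 <= w i) -> \sum_(i <- s) w i <= 1 ->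
  J (\sum_(i <- s) w i * a i) /\
  f (\sum_(i <- s) w i * a i) <= \sum_(i <- s) w i * f (a i).
Proof.
move=> hJ J0 hf f0 Ja.
elim: s w => [|i s IH] w w0; first by rewrite !big_nil.
rewrite !big_cons => w1.
have ws0 : 0 <= \sum_(j <- s) w j by apply: sumr_ge0.
have r0 : 0 <= 1 - w i by lra.
pose v j := w j / (1 - w i).
have v0 j : 0 <= v j by rewrite divr_ge0.
have scale g : (1 - w i) * (\sum_(j <- s) v j * g j) = \sum_(j <- s) w j * g j.
  have [e|ne] := eqVneq (1 - w i) 0; last first.
    rewrite mulr_sumr; apply: eq_bigr => j _.
    by rewrite mulrA /v mulrCA divff // mulr1.
  (* No mass is left besides w i, so all the other weights are 0. *)
  rewrite e mul0r; have : \sum_(j <- s) w j <= 0 by lra.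
  clear -w0; elim: s => [|j s IH]; first by rewrite !big_nil.
  rewrite !big_cons => h; have h0 := w0 j.
  have h1 : 0 <= \sum_(j <- s) w j by apply: sumr_ge0.
  rewrite -IH; last by lra.
  by rewrite (_ : w j = 0) ?mul0r ?add0r //; lra.
have v1 : \sum_(j <- s) v j <= 1.
  rewrite -mulr_suml; have [e|ne] := eqVneq (1 - w i) 0.
    by rewrite e invr0 mulr0.
  by rewrite ler_pdivrMr ?mul1r ?lt_def ?ne //; lra.
have [Jy fy] := IH v v0 v1.
rewrite -!scale; set y := \sum_(j <- s) v j * a j in Jy fy *.
have wi1 : w i <= 1 by lra.
have wi0 := w0 i.
split.
  have [ay|ya] := leP (a i) y.
    by apply: (hJ _ _ (Ja i) Jy); apply/andP; split; nra.
  by apply: (hJ _ _ Jy (Ja i)); apply/andP; split; nra.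
have p01 : Itv.spec (@Itv.num_sem R) (Itv.Real `[0%Z, 1%Z]%R) (w i).
  by rewrite /= /Itv.num_sem /= in_itv /= wi1 wi0 num_real.
have := hf (Itv.mk p01) (a i) y (mem_set (Ja i)) (mem_set Jy).
rewrite !convRE /=; move/le_trans; apply.
by rewrite lerD2l ler_wpM2l.
Qed.

(** Both sides change by k * th when th is subtracted from every c_i, because the
weights have total mass k.  With th the k-th largest value, the right-hand side
becomes the sum of all the positive parts of c_i - th, which bounds any
combination of the c_i - th with weights in [0, 1]. *)
Lemma weighted_sum_le_top (R : realType) (I : finType) (c t : I -> R) (k : nat) :
  (forall i, 0 <= t i <= 1) -> \sum_i t i = k%:R ->
  \sum_i t i * c i <=
  \sum_(j < k) (sort (fun x y => y <= x) [seq c i | i <- enum I])`_j.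
Proof.
move=> t01 tk; set s := sort _ _.
have ss : size s = #|I| by rewrite size_sort size_map -cardE.
have ks : (k <= size s)%N.
  rewrite ss -(ler_nat R) -tk -sum1_card natr_sum.
  by apply: ler_sum => i _; case/andP: (t01 i).
have s_mono i j : (i <= j)%N -> (j < size s)%N -> s`_j <= s`_i.
  have geT : transitive (fun x y : R => y <= x).
    by move=> x y z yx xz; exact: le_trans xz yx.
  have sorted_s : sorted (fun x y => y <= x) s.
    by apply: sort_sorted => x y; exact: le_total.
  move=> ij js.
  apply: (sorted_leq_nth geT _ 0 sorted_s) => //.
  by rewrite inE (leq_ltn_trans ij).
(* For k = 0 this is the largest value, and all the positive parts vanish. *)
pose th := s`_k.-1.
suff : \sum_i t i * (c i - th) <= \sum_(j < k) (s`_j - th).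
  under eq_bigr do rewrite mulrBr.
  by rewrite !sumrB -mulr_suml tk sumr_const card_ord mulr_natl lerD2r.
have -> : \sum_(j < k) (s`_j - th) = \sum_(x <- s) Num.max (x - th) 0.
  rewrite (big_nth 0) (big_cat_nat (n := k)) //= [X in _ + X]big1_seq ?addr0.
    rewrite big_mkord; apply: eq_bigr => j _.
    have jk := ltn_ord j; rewrite max_l // subr_ge0 s_mono //.
      by rewrite -ltnS prednK // (leq_ltn_trans _ jk).
    by rewrite (leq_trans _ ks) // prednK // (leq_ltn_trans _ jk).
  move=> j /=; rewrite mem_index_iota => /andP[kj js].
  by rewrite max_r // subr_le0 s_mono // (leq_trans (leq_pred _)).
rewrite (perm_big _ (permEl (perm_sort _ _))) big_map big_enum /=.
apply: ler_sum => i _; have /andP[t0 t1] := t01 i.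
rewrite le_max; have [h|h] := leP 0 (c i - th).
  by rewrite ler_piMl.
by rewrite orbC mulr_ge0_le0 // ltW.
Qed.

Lemma sum_sorted_choose (R : realType) (I : finType) (c : I -> R) (k : nat) :
  (k <= #|I|)%N -> exists2 S : {set I}, #|S| = k &
  \sum_(j < k) (sort (fun x y => y <= x) [seq c i | i <- enum I])`_j =
  \sum_(i in S) c i.
Proof.
move=> kI; rewrite sort_map; set s := sort _ _.
have us : uniq s by rewrite sort_uniq enum_uniq.
have ss : size s = #|I| by rewrite size_sort -cardE.
exists [set i in take k s].
  by rewrite cardsE (card_uniqP (take_uniq k us)) size_takel // ss.
rewrite -(big_mkord xpredT (fun j => (map c s)`_j)).
rewrite [RHS](eq_bigl (mem (take k s))) => [|i]; last by rewrite inE.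
rewrite -big_uniq ?take_uniq //=.
transitivity (\sum_(x <- take k (map c s)) x); last by rewrite -map_take big_map.
rewrite [RHS](big_nth 0) size_takel ?size_map ?ss // !big_nat.
by apply: eq_bigr => j /andP[_ jk]; rewrite nth_take.
Qed.

(** * Unitarily diagonalized Hermitian matrices *)

Section UnitaryDiagonal.
Variable R : realType.
Implicit Types n : nat.

(** Every Hermitian matrix has this form with P unitary ([herm_udiag]), and
quadratic forms and the functional calculus are then explicit.  The columns of
P^t* are the eigenvectors. *)
Definition udiag n (P : 'M[R[i]]_n) (d : 'rV[R]_n) : 'M[R[i]]_n :=
  P^t* *m diag_mx (map_mx (real_complex R) d) *m P.

Definition normsq (z : R[i]) : R := complex.Re z ^+ 2 + complex.Im z ^+ 2.

Lemma normsq_ge0 z : 0 <= normsq z.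
Proof. by rewrite addr_ge0 // sqr_ge0. Qed.

Lemma normsqE z : (normsq z)%:C = z^* * z.
Proof. by rewrite /normsq add_Re2_Im2 normCK mulrC. Qed.

Lemma qform_udiag n (P : 'M[R[i]]_n) d (x : 'cV_n) :
  qform (udiag P d) x = (\sum_i normsq ((P *m x) i 0) * d 0 i)%:C.
Proof.
have -> : qform (udiag P d) x =
    ((P *m x)^t* *m (diag_mx (map_mx (real_complex R) d) *m (P *m x))) 0 0.
  by rewrite /qform /udiag trmx_mul map_mxM !mulmxA.
rewrite !mxE raddf_sum; apply: eq_bigr => i _.
by rewrite mul_diag_mx !mxE /= rmorphM /= normsqE mulrCA mulrC.
Qed.

Lemma udiag_herm n (P : 'M[R[i]]_n) d : udiag P d \is hermsymmx.
Proof.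
apply/is_hermitianmxP; rewrite expr0 scale1r /udiag !trmx_mul !map_mxM trmxCK.
rewrite mulmxA tr_diag_mx map_diag_mx -map_mx_comp; congr (_ *m diag_mx _ *m _).
by apply/rowP => i; rewrite !mxE; exact: esym (conjc_real _).
Qed.

Lemma herm_udiag n (A : 'M[R[i]]_n) : A \is hermsymmx ->
  A = udiag (spectralmx A) (\row_i complex.Re (spectral_diag A 0 i)).
Proof.
move=> hA; have /orthomx_spectralP {1}-> := hermitian_normalmx hA.
rewrite invmx_unitary ?spectral_unitarymx // /udiag; congr (_ *m diag_mx _ *m _).
by apply/rowP => i; rewrite !mxE spectral_diag_Re.
Qed.

Lemma mxfun_udiag n f (P : 'M[R[i]]_n) d : P \is unitarymx ->
  mxfun f (udiag P d) = udiag P (map_mx f d).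
Proof.
move=> uP; rewrite (mxfunE f uP (d := d)) /udiag invmx_unitary //.
by congr (_ *m diag_mx _ *m _); apply/rowP => i; rewrite !mxE.
Qed.

Lemma tr_mxfun_udiag n f (P : 'M[R[i]]_n) d : P \is unitarymx ->
  \tr (mxfun f (udiag P d)) = (\sum_i f (d 0 i))%:C.
Proof.
move=> uP; rewrite mxfun_udiag // /udiag mxtrace_mulC mulmxA (unitarymxP uP).
rewrite mul1mx mxtrace_diag raddf_sum; apply: eq_bigr => i _.
by rewrite !mxE.
Qed.

(** By [tr_mxfun_udiag] the sum of g over the diagonal is the trace of the
functional calculus of g, hence does not depend on the diagonalization.  Taking for g the
indicator function of p shows that any two diagonals have equally many entries
satisfying p, hence are permutations of each other. *)
Lemma eigvals_udiag n (P : 'M[R[i]]_n) d : P \is unitarymx ->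
  eigvals (udiag P d) = sort (fun x y => y <= x) [seq d 0 i | i <- enum 'I_n].
Proof.
move=> uP; set A := udiag P d; have AE : A = _ := herm_udiag (udiag_herm P d).
rewrite /eigvals; apply/perm_sortP.
- by move=> x y; exact: le_total.
- by move=> x y z yx xz; exact: le_trans xz yx.
- by move=> x y; rewrite andbC; exact: le_anti.
have cnt (p : pred R) (c : 'I_n -> R) :
    (count p [seq c i | i <- enum 'I_n])%:R = \sum_i (p (c i))%:R :> R.
  rewrite -sum1_count big_map big_enum_cond /= natr_sum big_mkcond /=.
  by apply: eq_bigr => i _; case: (p _).
apply/permP => p; apply/eqP; rewrite -(eqr_nat R) !cnt.
apply/eqP; apply: complexI.
rewrite -(tr_mxfun_udiag (fun x => (p x)%:R) d uP) -/A [in RHS]AE.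
rewrite tr_mxfun_udiag ?spectral_unitarymx //.
by congr (_%:C); apply: eq_bigr => i _; rewrite mxE.
Qed.

(** The vectors Q *m col j U are the columns of the unitary matrix Q *m U, whose
rows and columns are all unit vectors. *)
Lemma unitary_doubly_stochastic n (Q U : 'M[R[i]]_n) :
  Q \is unitarymx -> U \is unitarymx ->
  (forall i, \sum_j normsq ((Q *m col j U) i 0) = 1) /\
  (forall j, \sum_i normsq ((Q *m col j U) i 0) = 1).
Proof.
move=> uQ uU; pose W := Q *m U.
have WE i j : (Q *m col j U) i 0 = W i j.
  by rewrite !mxE; apply: eq_bigr => k _; rewrite mxE.
have /unitarymxP WW : W \is unitarymx by apply: mul_unitarymx.
have WtW : W^t* *m W = 1%:M by exact: mulmx1C.
split=> i; apply: complexI; rewrite raddf_sum.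
  transitivity ((W *m W^t*) i i); last by rewrite WW mxE eqxx.
  by rewrite mxE; apply: eq_bigr => j _; rewrite WE /= normsqE !mxE mulrC.
transitivity ((W^t* *m W) i i); last by rewrite WtW mxE eqxx.
by rewrite mxE; apply: eq_bigr => j _; rewrite WE /= normsqE !mxE.
Qed.

(** Ky Fan's maximum principle, for orthonormal vectors taken among the columns
of a unitary U.  In an eigenbasis of C the left-hand side is a combination of
the eigenvalues, whose weights are sums over S of rows of a doubly stochastic
matrix: they lie in [0, 1] and have total mass #|S|. *)
Lemma ky_fan_le n (C U : 'M[R[i]]_n) (S : {set 'I_n}) :
  C \is hermsymmx -> U \is unitarymx ->
  \sum_(j in S) complex.Re (qform C (col j U)) <= \sum_(j < #|S|) lambda C j.
Proof.
move=> /herm_udiag ->; set Q := spectralmx C; set c := \row_i _ => uU.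
have uQ : Q \is unitarymx := spectral_unitarymx C.
have [rowW colW] := unitary_doubly_stochastic uQ uU.
rewrite /lambda eigvals_udiag //.
under eq_bigr do rewrite qform_udiag /=.
rewrite exchange_big /=; under eq_bigr do rewrite -mulr_suml.
apply: weighted_sum_le_top => [i|].
  rewrite sumr_ge0 /= => [|j _]; last exact: normsq_ge0.
  rewrite -(rowW i) [leRHS](bigID (mem S)) /= lerDl sumr_ge0 // => j _.
  exact: normsq_ge0.
rewrite exchange_big /=; under eq_bigr do rewrite colW.
by rewrite sumr_const.
Qed.

Lemma herm0 n : (0 : 'M[R[i]]_n) \is hermsymmx.
Proof. by apply/is_hermitianmxP; rewrite trmx0 map_mx0 scaler0. Qed.

Lemma udiag_psd n (P : 'M[R[i]]_n) (d : 'rV_n) : (forall i, 0 <= d 0 i) ->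
  loewner_le 0 (udiag P d).
Proof.
move=> d0; split; [exact: herm0|exact: udiag_herm|move=> x].
rewrite qform_udiag /qform mul0mx mulmx0 mxE ler0c.
by apply: sumr_ge0 => i _; rewrite mulr_ge0 // normsq_ge0.
Qed.

(** For P unitary, [udiag P (delta_mx 0 i)] is the orthogonal projection on the
i-th eigenvector, so this is the spectral decomposition. *)
Lemma udiag_spectral_sum n (P : 'M[R[i]]_n) d :
  udiag P d = \sum_i (d 0 i)%:C *: udiag P (delta_mx 0 i).
Proof.
have dE : map_mx (real_complex R) d =
    \sum_i (d 0 i)%:C *: map_mx (real_complex R) (delta_mx 0 i).
  rewrite {1}(row_sum_delta d) [LHS]raddf_sum; apply: eq_bigr => i _.
  by rewrite /= map_mxZ.
rewrite /udiag dE linear_sum /= mulmx_sumr mulmx_suml.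
by apply: eq_bigr => i _; rewrite linearZ /= -scalemxAr -scalemxAl.
Qed.

Lemma udiag_in n (J : set R) (P : 'M[R[i]]_n) (d : 'rV_n) :
  P \is unitarymx -> herm_in J (udiag P d) -> forall i, J (d 0 i).
Proof.
move=> uP [_ hJ] i.
have /hJ [x Jx /complexI ->] // : eigenvalue (udiag P d) (d 0 i)%:C.
apply/eigenvalueP; exists (row i P).
  rewrite -row_mul /udiag !mulmxA (unitarymxP uP) mul1mx.
  by apply/rowP => j; rewrite mul_diag_mx !mxE.
apply/eqP => Pi0; move/unitarymxP/(congr1 (row i)): uP.
rewrite row_mul Pi0 mul0mx => /rowP/(_ i)/eqP.
by rewrite !mxE eqxx eq_sym oner_eq0.
Qed.

(** * Positive linear maps *)

Lemma qform_sum n I (r : seq I) (c : I -> R[i]) (F : I -> 'M[R[i]]_n) x :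
  qform (\sum_(i <- r) c i *: F i) x = \sum_(i <- r) c i * qform (F i) x.
Proof.
rewrite /qform mulmx_suml mulmx_sumr summxE; apply: eq_bigr => i _.
by rewrite -scalemxAl -scalemxAr mxE.
Qed.

Lemma herm_sum n I (r : seq I) (c : I -> R) (F : I -> 'M[R[i]]_n) :
  (forall i, F i \is hermsymmx) -> \sum_(i <- r) (c i)%:C *: F i \is hermsymmx.
Proof.
move=> hF; elim/big_ind: _ => [|X Y /is_hermitianmxP hX /is_hermitianmxP hY|i _].
- exact: herm0.
- apply/is_hermitianmxP; rewrite linearD /= map_mxD scalerDr.
  by rewrite -hX -hY.
apply/is_hermitianmxP; have /is_hermitianmxP := hF i.
rewrite expr0 !scale1r linearZ /= map_mxZ /= => {1}->.
by congr (_ *: _); exact: esym (conjc_real _).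
Qed.

(** Spectral projections are positive semidefinite, so their images are
Hermitian, and real combinations of these are too. *)
Lemma positive_map_herm n m (Psi : {linear 'M[R[i]]_n -> 'M[R[i]]_m}) A :
  positive_map Psi -> A \is hermsymmx -> Psi A \is hermsymmx.
Proof.
move=> hPsi /herm_udiag ->; rewrite udiag_spectral_sum raddf_sum /=.
under eq_bigr do rewrite linearZ /=.
apply: herm_sum => i.
have [|_ //] := hPsi (udiag (spectralmx A) (delta_mx 0 i)).
by apply: udiag_psd => j; rewrite !mxE ler0n.
Qed.

(** The weights w_i = <Psi(P_i) x, x>, where the P_i are the spectral projections
of A, have total mass at most 1; the claim is Jensen's inequality for them. *)
Lemma convex_compression_le n m (J : set R) (f : R -> R)
    (Psi : {linear 'M[R[i]]_n -> 'M[R[i]]_m}) (A : 'M[R[i]]_n) (x : 'cV_m) :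
  is_interval J -> J 0 -> @convex_function R R^o J f -> f 0 <= 0 ->
  herm_in J A -> positive_map Psi -> loewner_le (Psi 1%:M) 1%:M ->
  (x^t* *m x) 0 0 = 1 ->
  f (complex.Re (qform (Psi A) x)) <= complex.Re (qform (Psi (mxfun f A)) x).
Proof.
move=> hJ J0 hf f0 hA hPsi [_ _ Psi1] x1.
have uQ := spectral_unitarymx A; have [/herm_udiag AE _] := hA.
move: AE uQ hA; set Q := spectralmx A; set a := \row_i _ => -> uQ hA.
pose w i := complex.Re (qform (Psi (udiag Q (delta_mx 0 i))) x).
have w0 i : 0 <= w i /\ qform (Psi (udiag Q (delta_mx 0 i))) x = (w i)%:C.
  have [|_ _ /(_ x)] := hPsi (udiag Q (delta_mx 0 i)).
    by apply: udiag_psd => j; rewrite !mxE ler0n.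
  rewrite /qform mul0mx mulmx0 mxE -/(qform _ _) => h.
  by split; [move: h; rewrite lecE => /andP[] | rewrite RRe_real // ger0_real].
have qE d : qform (Psi (udiag Q d)) x = (\sum_i w i * d 0 i)%:C.
  rewrite udiag_spectral_sum raddf_sum /=.
  under eq_bigr do rewrite linearZ /=.
  rewrite qform_sum rmorph_sum; apply: eq_bigr => i _ /=.
  by rewrite (w0 i).2 rmorphM /= mulrC.
have w1 : \sum_i w i <= 1.
  have udiag1 : udiag Q (const_mx 1) = 1%:M.
    by rewrite /udiag map_const_mx diag_const_mx mulmx1; exact/mulmx1C/unitarymxP.
  have := Psi1 x; rewrite /qform mul1mx x1 -/(qform _ _) -udiag1 qE.
  by rewrite -(rmorph1 (real_complex R)) lecR; under eq_bigr do rewrite mxE mulr1.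
rewrite mxfun_udiag // !qE /=.
under [leRHS]eq_bigr do rewrite [X in _ * X]mxE.
have [_] := jensen_subprob hJ J0 hf f0 (udiag_in uQ hA) (fun i => (w0 i).1) w1.
exact.
Qed.

End UnitaryDiagonal.

(** * Weighted sums of positive maps, and the majorization *)

Section WeightedSum.
Variables (R : realType) (n m l : nat).
Variables (Phi : 'I_l -> {linear 'M[R[i]]_n -> 'M[R[i]]_m}) (alpha : 'I_l -> R).

Definition map_comb (X : 'M[R[i]]_n) : 'M[R[i]]_m :=
  \sum_(i < l) (alpha i)%:C *: Phi i X.

Lemma map_comb_is_linear : linear map_comb.
Proof.
move=> c X Y; rewrite /map_comb scaler_sumr -big_split /=.
by apply: eq_bigr => i _; rewrite linearP scalerDr !scalerA mulrC.
Qed.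

HB.instance Definition _ := GRing.isLinear.Build R[i] 'M[R[i]]_n 'M[R[i]]_m *:%R
  map_comb map_comb_is_linear.

Lemma map_comb_positive : (forall i, positive_map (Phi i)) ->
  (forall i, 0 <= alpha i) -> positive_map map_comb.
Proof.
move=> hPhi halpha X X0.
split; [exact: herm0|apply: herm_sum => i; by case: (hPhi i _ X0)|move=> x].
rewrite qform_sum /qform mul0mx mulmx0 mxE; apply: sumr_ge0 => i _.
have [_ _ /(_ x)] := hPhi i _ X0.
by rewrite {1}/qform mul0mx mulmx0 mxE => h; rewrite mulr_ge0 // ler0c.
Qed.

End WeightedSum.

Theorem theorem2p7 (R : realType) (n m l : nat)
  (hn : (0 < n)%N) (hm : (0 < m)%N) (hl : (0 < l)%N)
  (J : set R) (hJ : is_interval J) (J0 : J 0)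
  (f : R -> R) (hf : @convex_function R R^o J f) (f0 : f 0 <= 0)
  (A : 'M[R[i]]_n) (hA : herm_in J A)
  (Phi : 'I_l -> {linear 'M[R[i]]_n -> 'M[R[i]]_m})
  (hPhi : forall i, positive_map (Phi i))
  (alpha : 'I_l -> R) (halpha : forall i, 0 <= alpha i)
  (h0 : loewner_le 0 (\sum_(i < l) (alpha i)%:C *: Phi i 1%:M))
  (h1 : loewner_le (\sum_(i < l) (alpha i)%:C *: Phi i 1%:M) 1%:M)
  (k : nat) (hk : (1 <= k <= m)%N) :
  \sum_(j < k) lambda (mxfun f (\sum_(i < l) (alpha i)%:C *: Phi i A)) j <=
  \sum_(j < k) lambda (\sum_(i < l) (alpha i)%:C *: Phi i (mxfun f A)) j.
Proof.
pose Psi : {linear 'M[R[i]]_n -> 'M[R[i]]_m} := map_comb Phi alpha.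
have posPsi : positive_map Psi := map_comb_positive hPhi halpha.
rewrite -!/(Psi _) in h1 *.
have [hermA _] := hA.
have hermfA : mxfun f A \is hermsymmx.
  by rewrite (herm_udiag hermA) mxfun_udiag ?spectral_unitarymx // udiag_herm.
have BE := herm_udiag (positive_map_herm posPsi hermA).
have uP := spectral_unitarymx (Psi A).
set P := spectralmx _ in BE uP; set b := \row_i _ in BE.
(* The j-th column of P^t* is a unit eigenvector of Psi A. *)
have qB j : qform (Psi A) (col j (P^t*)) = (b 0 j)%:C.
  have Pcol : P *m col j (P^t*) = delta_mx j 0.
    by rewrite colE mulmxA (unitarymxP uP) mul1mx.
  rewrite BE qform_udiag Pcol (bigD1 j) //= big1 => [|i ij].
    by rewrite mxE !eqxx /normsq /= expr1n expr0n /= !addr0 mul1r.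
  by rewrite mxE (negPf ij) /normsq /= expr0n /= addr0 mul0r.
have [|S Sk topE] := sum_sorted_choose (fun j => f (b 0 j)) (k := k).
  by rewrite card_ord; case/andP: hk.
have -> : \sum_(j < k) lambda (mxfun f (Psi A)) j = \sum_(j in S) f (b 0 j).
  rewrite -topE BE mxfun_udiag // /lambda eigvals_udiag //.
  by under eq_map do rewrite mxE.
rewrite -{}Sk.
apply: le_trans (ky_fan_le S (positive_map_herm posPsi hermfA) (U := P^t*) _).
  apply: ler_sum => j _; rewrite -[b 0 j]/(complex.Re (b 0 j)%:C) -qB.
  apply: (convex_compression_le hJ) => //.
  transitivity ((P *m P^t*) j j); last by rewrite (unitarymxP uP) mxE eqxx.
  by rewrite !mxE; apply: eq_bigr => i _; rewrite !mxE conjCK.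
by rewrite trmxC_unitary.
Qed.
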